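(* Let $\nu\in(0,1]$, $x>0$ and $0<u\le 1$. Then $$\sum_{k=0}^{\infty}(ux)^{k}\,E_{\nu,\nu k+1}^{k+1}(-x)=E_{\nu,1}\bigl(x(u-1)\bigr).$$
   Context: The generalized Mittag-Leffler function is $E_{\alpha,\beta}^{\gamma}(z)=\sum_{r=0}^{\infty}\frac{(\gamma)_r z^r}{r!\,\Gamma(\alpha r+\beta)}$ with $(\gamma)_r=\gamma(\gamma+1)\cdots(\gamma+r-1)$ for $r\ge1$ and $(\gamma)_0=1$; the Mittag-Leffler function is $E_{\alpha,\beta}(z)=E_{\alpha,\beta}^{1}(z)=\sum_{r=0}^{\infty}\frac{z^r}{\Gamma(\alpha r+\beta)}$. *)

(* Defs.v *)
From HB Require Import structures.
From mathcomp Require Import all_boot all_order all_algebra.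
From mathcomp Require Import all_classical all_reals all_analysis.
Set Implicit Arguments.
Unset Strict Implicit.
Unset Printing Implicit Defensive.
Import Order.TTheory GRing.Theory Num.Theory.
Import numFieldNormedType.Exports.
Local Open Scope classical_set_scope.
Local Open Scope ring_scope.

(* Euler's integral; it is the Gamma function on z > 0 only (the integral
   diverges for z <= 0, where the value given here is meaningless). *)
Definition Gamma (R : realType) (z : R) : R :=
  (\int[lebesgue_measure]_(t in `]0, +oo[) (t `^ (z - 1) * expR (- t)))%R.

Definition pochhammer (R : realType) (c : R) (r : nat) : R :=
  \prod_(i < r) (c + i%:R).

Definition gen_mittag_leffler_term (R : realType) (alpha beta gam z : R)
    : R^nat :=
  fun r => pochhammer gam r * z ^+ r / (r`!%:R * Gamma (alpha * r%:R + beta)).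

(* Sum of the series above; an unspecified value if the series diverges, so
   convergence has to be stated separately. *)
Definition gen_mittag_leffler (R : realType) (alpha beta gam z : R) : R :=
  limn (series (gen_mittag_leffler_term alpha beta gam z)).

Definition mittag_leffler (R : realType) (alpha beta z : R) : R :=
  gen_mittag_leffler alpha beta 1 z.

Lemma pochhammer1 (R : realType) (r : nat) : pochhammer (1 : R) r = r`!%:R.
Proof.
elim: r => [|r IH]; first by rewrite /pochhammer big_ord0.
by rewrite /pochhammer big_ord_recr /= -/(pochhammer _ _) IH factS mulnC natrM
  -natr1 addrC.
Qed.

Lemma mittag_lefflerE (R : realType) (alpha beta z : R) :
  mittag_leffler alpha beta z =
  limn (series (fun r => z ^+ r / Gamma (alpha * r%:R + beta))).
Proof.
rewrite /mittag_leffler /gen_mittag_leffler; congr (limn (series _)).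
apply/funext => r; rewrite /gen_mittag_leffler_term pochhammer1.
by rewrite -mulf_div divff ?mul1r // pnatr_eq0 -lt0n fact_gt0.
Qed.

(* Main.v *)
(* With c_n = 1 / Gamma (nu n + 1), the identities
   (k+1)_r / r! = C(k+r, k) and nu r + (nu k + 1) = nu (k + r) + 1 turn the left
   side into the double series of the terms
   c_{k+r} C(k+r, k) (u x)^k (- x)^r, whose sum over k + r = n is
   c_n (u x - x)^n by the binomial theorem. The rearrangement is justified by
   absolute convergence: restricting Euler's integral to [M, M + 1] gives
   Gamma (nu n + 1) >= M^(nu n) e^(-(M + 1)) for every M > 0, so that
   sum c_n s^n converges for every s. *)
Require Import Defs.
From HB Require Import structures.
From mathcomp Require Import all_boot all_order all_algebra.
From mathcomp Require Import all_classical all_reals all_analysis.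
From mathcomp Require Import measurable_realfun ring.
Import Order.TTheory GRing.Theory Num.Theory.
Import numFieldNormedType.Exports.
Local Open Scope classical_set_scope.
Local Open Scope ring_scope.

Lemma Gamma_ge0 (R : realType) (z : R) : 0 <= Gamma z.
Proof.
apply: fine_ge0; apply: integral_ge0 => t _.
by rewrite lee_fin mulr_ge0 ?powR_ge0 ?expR_ge0.
Qed.

(** For [1 <= z] the power is nondecreasing, so on [[M, M + 1]] each factor of the integrand is at
    least its smaller endpoint value. [M] stays free, to be adapted later to a given geometric
    growth. *)
Lemma inv_Gamma_le (R : realType) (M z : R) : 0 < M -> 1 <= z ->
  (Gamma z)^-1 <= expR (M + 1) / M `^ (z - 1).
Proof.
move=> M0 z1.
have bound : ((M `^ (z - 1) * expR (- (M + 1)))%:E <=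
    \int[lebesgue_measure]_(t in `]0%R, +oo[)
      (t `^ (z - 1) * expR (- t))%:E)%E.
  have f0 (t : R) : (0 <= (t `^ (z - 1) * expR (- t))%:E)%E.
    by rewrite lee_fin mulr_ge0 ?powR_ge0 ?expR_ge0.
  have mf (D : set R) : measurable_fun D
      (fun t : R => (t `^ (z - 1) * expR (- t))%:E).
    apply: (@measurable_funS _ _ _ _ setT) => //.
    apply/measurable_EFinP; apply: measurable_funM => //.
    by apply: measurableT_comp => //.
  apply: (@le_trans _ _ (\int[lebesgue_measure]_(t in `[M, (M + 1)%R]%classic)
      (t `^ (z - 1) * expR (- t))%:E)%E); last first.
    apply: ge0_subset_integral => //=.
      exact: mf.
    move=> t /=; rewrite !in_itv /= => /andP[Mt _].
    by rewrite andbT (lt_le_trans M0).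
  have -> : ((M `^ (z - 1) * expR (- (M + 1)))%:E =
      \int[lebesgue_measure]_(t in `[M, (M + 1)%R]%classic)
         (cst (M `^ (z - 1) * expR (- (M + 1)))%:E t))%E.
    rewrite integral_cst//= lebesgue_measure_itv/= lte_fin ltrDl ltr01.
    by rewrite -EFinB addrAC subrr add0r mule1.
  apply: ge0_le_integral => //=.
  - by move=> t _; rewrite lee_fin mulr_ge0 ?powR_ge0 ?expR_ge0.
  - exact: mf.
  - move=> t /=; rewrite in_itv /= => /andP[Mt tM]; rewrite lee_fin.
    rewrite ler_pM ?powR_ge0 ?expR_ge0 ?ler_expR ?lerN2//.
    by rewrite ge0_ler_powR ?subr_ge0 ?nnegrE ?(ltW M0)// (le_trans (ltW M0)).
have lb0 : 0 < M `^ (z - 1) * expR (- (M + 1)).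
  by rewrite mulr_gt0 ?powR_gt0 ?expR_gt0.
have -> : expR (M + 1) / M `^ (z - 1) =
    (M `^ (z - 1) * expR (- (M + 1)))^-1 by rewrite expRN invf_div.
(* If the integral were infinite, [fine] would turn it into 0, whose inverse
   is again 0. *)
rewrite /Gamma /Rintegral.
case: (integral _ _ _) bound => [r||] /=; rewrite ?invr0 ?invr_ge0 ?(ltW lb0)//.
by rewrite lee_fin => le_r; rewrite lef_pV2// posrE (lt_le_trans lb0).
Qed.

Lemma is_cvg_inv_Gamma_series (R : realType) (nu s : R) : 0 < nu -> 0 <= s ->
  cvgn (series (fun n => `|(Gamma (nu * n%:R + 1))^-1| * s ^+ n)).
Proof.
move=> nu0 s0.
have s1 : 0 < 2 * (s + 1) by rewrite mulr_gt0// ltr_wpDl.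
(* Chosen so that [M] to the power nu n is [(2 * (s + 1)) ^+ n]; the terms are then at most e^(M +
   1) 2^(-n). Using [s + 1] keeps the base positive when [s = 0]. *)
pose M := (2 * (s + 1)) `^ nu^-1.
have M0 : 0 < M by rewrite powR_gt0.
have half : `|2^-1 : R| < 1 by rewrite gtr0_norm ?invr_gt0// invf_lt1// ltr1n.
have := @is_cvg_geometric_series _ (expR (M + 1)) _ half.
apply: series_le_cvg => n /=.
- by rewrite mulr_ge0 ?exprn_ge0.
- by rewrite mulr_ge0 ?expR_ge0// exprn_ge0// invr_ge0.
rewrite ger0_norm ?invr_ge0 ?Gamma_ge0//.
have := @inv_Gamma_le _ M (nu * n%:R + 1) M0.
rewrite lerDr mulr_ge0 ?(ltW nu0)// => /(_ isT).
rewrite addrK /M -powRrM mulrA mulVf ?gt_eqF// mul1r powR_mulrn ?(ltW s1)//.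
move=> /(ler_wpM2r (exprn_ge0 n s0)) /le_trans; apply.
rewrite -mulrA ler_wpM2l ?expR_ge0// exprMn invfM exprVn -mulrA.
rewrite ler_piMr ?invr_ge0 ?exprn_ge0// mulrC ler_pdivrMr ?exprn_gt0 ?ltr_wpDl//.
by rewrite mul1r lerXn2r ?nnegrE ?addr_ge0// lerDl.
Qed.

Lemma cvg_series_shift (R : numFieldType) (f : R^nat) (K : nat) (l : R) :
  (forall n, (n < K)%N -> f n = 0) ->
  series (fun n => f (K + n)%N) @ \oo --> l <-> series f @ \oo --> l.
Proof.
move=> f0; rewrite -(cvg_shiftn K (series f)).
suff -> : (fun n => series f (n + K)%N) = series (fun n => f (K + n)%N) by [].
apply/funext => n; rewrite series_addn {1}/series /= big_nat big1 ?add0r.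
  by rewrite -{1}[K]add0n big_addn addnK; apply: eq_bigr => i _; rewrite addnC.
by move=> i /andP[_ /f0].
Qed.

Lemma cvg_sum (R : numFieldType) (K : nat) (f : nat -> R^nat) (l : R^nat) :
  (forall k, f k @ \oo --> l k) ->
  (fun n => \sum_(k < K) f k n) @ \oo --> \sum_(k < K) l k.
Proof.
move=> fl; elim: K => [|K IH].
  by under eq_fun do rewrite big_ord0; rewrite big_ord0; exact: cvg_cst.
under eq_fun do rewrite big_ord_recr; rewrite big_ord_recr /=.
by apply: cvgD.
Qed.

Section double_binomial_series.
Context (R : realType) (c : R^nat) (y w : R).
Context (y_neq0 : y != 0).
Let t (n : nat) : R := `|c n| * (`|y| + `|w|) ^+ n.
Context (cvg_t : cvgn (series t)).

(** The double series indexed by k and the total degree n = k + r. The binomial coefficient kills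
    the entries with n < k, where the truncated [n - k] would be wrong. *)
Let b (k n : nat) : R := c n * (y ^+ k * w ^+ (n - k) *+ 'C(n, k)).

(** By the binomial theorem [t n] is the sum of all the [|b k n|] with k <= n. The predicate serves
    both for a single k and for the tail K <= k. *)
Let norm_sum_b (P : pred nat) (n : nat) :
  \sum_(k < n.+1 | P k) `|b k n| <= t n.
Proof.
rewrite /t addrC exprDn mulr_sumr [leRHS](bigID (fun k : 'I_n.+1 => P k)) /=.
rewrite -[leLHS]addr0 lerD//; last first.
  by apply: sumr_ge0 => k _; rewrite mulr_ge0 ?mulrn_wge0 ?mulr_ge0 ?exprn_ge0.
apply: ler_sum => k _; rewrite /b normrM normrMn normrM !normrX.
by rewrite [_ ^+ k * _]mulrC.
Qed.

Let b_gt (k n : nat) : (n < k)%N -> b k n = 0.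
Proof. by move=> nk; rewrite /b bin_small// mulr0n mulr0. Qed.

Let norm_b (k n : nat) : `|b k n| <= t n.
Proof.
have [nk|kn] := ltnP n k.
  by rewrite b_gt// normr0 mulr_ge0 ?exprn_ge0 ?addr_ge0.
apply: le_trans (norm_sum_b (pred1 k) n).
by rewrite (big_pred1 (Ordinal (kn : k < n.+1)%N)) => [|i]//; rewrite -val_eqE.
Qed.

Let cvg_of_le_t (f : R^nat) : (forall n, `|f n| <= t n) -> cvgn (series f).
Proof.
move=> ft; apply: normed_cvg; apply: series_le_cvg cvg_t => // n; first exact: normr_ge0.
exact: le_trans (ft n).
Qed.

Let a (k r : nat) : R := 'C(k + r, k)%:R * w ^+ r * c (k + r)%N.

(** [a k r] is [b k (k + r)] divided by [y ^+ k], and the skipped first k terms of [b k] vanish. *)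
Let cvg_a (k : nat) :
  series (a k) @ \oo --> y ^- k * limn (series (b k)).
Proof.
have yk : y ^+ k != 0 by rewrite expf_neq0.
rewrite (_ : a k = y ^- k *: (fun r => b k (k + r)%N)); last first.
  apply/funext => r; rewrite /a [RHS]/GRing.scale /= /b addKn.
  by rewrite -[X in _ = _ * (_ * X)]mulr_natl; field.
rewrite seriesZ; apply: cvgZr.
by apply/cvg_series_shift; [exact: b_gt | apply: cvg_of_le_t; exact: norm_b].
Qed.

Lemma is_cvg_binomial_row (k : nat) :
  cvgn (series (fun r => 'C(k + r, k)%:R * w ^+ r * c (k + r)%N)).
Proof. by apply/cvg_ex; exists (y ^- k * limn (series (b k))); exact: cvg_a. Qed.

Let norm_cyw (n : nat) : `|c n * (y + w) ^+ n| <= t n.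
Proof.
by rewrite normrM normrX ler_wpM2l// lerXn2r ?nnegrE ?addr_ge0// ler_normD.
Qed.

Lemma is_cvg_series_exprD : cvgn (series (fun n => c n * (y + w) ^+ n)).
Proof. exact: cvg_of_le_t norm_cyw. Qed.

(* The remainder after K columns involves only the terms b k n with
   K <= k <= n, hence is dominated by the tail of the absolutely convergent series t. *)
Let remainder (K : nat) :
  `|\sum_(k < K) limn (series (b k)) - limn (series (fun n => c n * (y + w) ^+ n))|
  <= limn (series t) - series t K.
Proof.
pose d n := \sum_(k < K) b k n - c n * (y + w) ^+ n.
have dE n : d n = - \sum_(k < n.+1 | (K <= k)%N) b k n.
  apply/eqP; rewrite /d subr_eq addrC; apply/eqP.
  rewrite [y + w]addrC exprDn mulr_sumr (bigID (fun k : 'I_n.+1 => (K <= k)%N)) /=.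
  rewrite (eq_bigr (fun k : 'I_n.+1 => b k n)) => [|k _]; last first.
    by rewrite /b [_ ^+ k * _]mulrC.
  (* Both sums are extended to the range below [maxn K n.+1] and compared termwise; indices k > n
     contribute 0. *)
  rewrite addrAC subrr add0r (big_ord_widen _ (b^~ n) (leq_maxl K n.+1)).
  rewrite (eq_bigr (fun k : 'I_n.+1 => b k n)) => [|k _]; last first.
    by rewrite /b [_ ^+ k * _]mulrC.
  rewrite (big_ord_widen_cond _ (fun k => ~~ (K <= k)%N) (b^~ n) (leq_maxr K n.+1)).
  rewrite big_mkcond [RHS]big_mkcond; apply: eq_bigr => k _.
  rewrite -ltnNge ltnS; case: ltnP => //= _; by case: leqP => // /b_gt.
have d0 n : (n < K)%N -> d n = 0.
  move=> nK; rewrite dE big_pred0 ?oppr0// => k.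
  by apply/negbTE; rewrite -ltnNge (leq_trans (ltn_ord k)).
have dt n : `|d n| <= t n.
  by rewrite dE normrN (le_trans (ler_norm_sum _ _ _)).
have dl : series d @ \oo --> \sum_(k < K) limn (series (b k)) -
    limn (series (fun n => c n * (y + w) ^+ n)).
  rewrite (_ : series d = (fun n => \sum_(k < K) series (b k) n) -
      series (fun n => c n * (y + w) ^+ n)); last first.
    by apply/funext => n; rewrite /series /= /d sumrB exchange_big.
  apply: cvgB; last exact: is_cvg_series_exprD.
  apply: (cvg_sum _ K (fun k => series (b k)) (fun k => limn (series (b k)))).
  by move=> k; apply: cvg_of_le_t; exact: norm_b.
(* As [d] vanishes below K, its partial sum up to m + K only involves degrees from K on, where [t]
   dominates it. *)
move: dl; rewrite -(cvg_shiftn K) => dl.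
have is_cvg_d := cvgP _ dl.
rewrite -(cvg_lim _ dl)// -lim_norm//.
apply: limr_le; first exact: is_cvg_norm.
apply: nearW => m /=.
rewrite series_addn {1}/series /= big_nat big1 ?add0r => [|i /andP[_ /d0]//].
apply: le_trans (ler_norm_sum _ _ _) _.
apply: (@le_trans _ _ (series t (m + K)%N - series t K)).
  by rewrite series_addn addrAC subrr add0r ler_sum.
rewrite lerD2r nondecreasing_cvgn_le//.
apply/nondecreasing_seqP => n; rewrite /series /= big_nat_recr//= lerDl.
exact: le_trans (dt n).
Qed.

Lemma cvg_double_binomial_series :
  series (fun k => y ^+ k *
    limn (series (fun r => 'C(k + r, k)%:R * w ^+ r * c (k + r)%N)))
    @ \oo --> limn (series (fun n => c n * (y + w) ^+ n)).
Proof.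
rewrite (_ : series _ = (fun K => \sum_(k < K) limn (series (b k)))); last first.
  apply/funext => K; rewrite /series /= big_mkord; apply: eq_bigr => k _.
  by rewrite (cvg_lim _ (@cvg_a k))// mulrA divff ?mul1r ?expf_neq0.
apply/subr_cvg0; apply: norm_cvg0.
apply: (@squeeze_cvgr _ _ _ _ (cst 0) (fun K => limn (series t) - series t K)).
- by apply: nearW => K; rewrite normr_ge0 remainder.
- exact: cvg_cst.
- by rewrite -(subrr (limn (series t))); apply: cvgB; [exact: cvg_cst|exact: cvg_t].
Qed.
End double_binomial_series.

(** Multiplied by k!, both sides become (k + r)!. *)
Lemma pochhammer_natE (R : realType) (k r : nat) :
  pochhammer (k%:R + 1 : R) r = 'C(k + r, k)%:R * r`!%:R.
Proof.
have fact_neq0 (n : nat) : n`!%:R != 0 :> R by rewrite pnatr_eq0 -lt0n fact_gt0.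
apply: (mulfI (fact_neq0 k)); transitivity ((k + r)`!%:R : R); last first.
  by rewrite -(@bin_fact (k + r) k) ?leq_addr// addKn !natrM mulrCA.
elim: r => [|r IH]; first by rewrite /pochhammer big_ord0 mulr1 addn0.
rewrite /pochhammer big_ord_recr /= -/(pochhammer _ _) mulrA IH.
by rewrite mulrC addnS factS natrM -[(k + r).+1]addn1 !natrD addrAC.
Qed.

Lemma gen_mittag_leffler_term_natE (R : realType) (nu z : R) (k : nat) :
  gen_mittag_leffler_term nu (nu * k%:R + 1) (k%:R + 1) z =
  (fun r => 'C(k + r, k)%:R * z ^+ r * (Gamma (nu * (k + r)%:R + 1))^-1).
Proof.
apply/funext => r; rewrite /gen_mittag_leffler_term pochhammer_natE addrA.
rewrite -mulrDr -natrD [(r + k)%N]addnC invfM.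
(* With the inverse abstracted, [field] asks only for r! to be nonzero, not for the Gamma value. *)
move: (Gamma _)^-1 => g.
by field; rewrite pnatr_eq0 -lt0n fact_gt0.
Qed.

Theorem mainTheorem7 (R : realType) (nu x u : R)
  (nu_gt0 : 0 < nu) (nu_le1 : nu <= 1) (x_gt0 : 0 < x)
  (u_gt0 : 0 < u) (u_le1 : u <= 1) :
  [/\ forall k : nat,
        cvgn (series (gen_mittag_leffler_term
                        nu (nu * k%:R + 1) (k%:R + 1) (- x))),
      cvgn (series (gen_mittag_leffler_term nu 1 1 (x * (u - 1)))) &
      series (fun k : nat => (u * x) ^+ k *
                gen_mittag_leffler nu (nu * k%:R + 1) (k%:R + 1) (- x))
        @ \oo --> mittag_leffler nu 1 (x * (u - 1))].
Proof.
pose c (n : nat) : R := (Gamma (nu * n%:R + 1))^-1.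
have ux_neq0 : u * x != 0 by rewrite gt_eqF ?mulr_gt0.
have summable : cvgn (series (fun n => `|c n| * (`|u * x| + `|- x|) ^+ n)).
  by apply: is_cvg_inv_Gamma_series; rewrite ?addr_ge0.
have mlE : gen_mittag_leffler_term nu 1 1 (x * (u - 1)) =
    (fun n => c n * (u * x + - x) ^+ n).
  (* The right side is the case k = 0 of the same formula, with x (u - 1) = u x + (- x). *)
  have := @gen_mittag_leffler_term_natE R nu (x * (u - 1)) 0.
  rewrite mulr0 !add0r => ->; apply/funext => n.
  by rewrite bin0 mul1r mulrC mulrBr mulr1 [x * u]mulrC.
split=> [k||].
- by rewrite gen_mittag_leffler_term_natE; exact: is_cvg_binomial_row summable k.
- by rewrite mlE; exact: is_cvg_series_exprD.
- rewrite /mittag_leffler /gen_mittag_leffler mlE.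
  under eq_fun do rewrite gen_mittag_leffler_term_natE.
  exact: cvg_double_binomial_series summable.
Qed.
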